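(* Let $\mathbb K$ be a field of characteristic different from $2$ and $n\ge1$. Let $X=\{x_1,\dots,x_n\}$ be even variables and $Y=\{y_1,\dots,y_{n+1}\}$ odd variables, and let $\widetilde Q$ be the superquiver with even vertices $x_1,\dots,x_n$, odd vertices $y_1,\dots,y_{n+1}$ and arrows (each of multiplicity one) $x_i\to x_{i+1}$ for $1\le i\le n-1$, and $x_i\to y_i$, $y_{i+1}\to x_i$ for $1\le i\le n$. Consider a generic superfrieze of width $n$ such that the even elements $a_{0,i-1}=x_i$ ($1\le i\le n$) and the odd elements $\beta_{\frac12,\frac12+i-1}=y_i$ ($1\le i\le n+1$) are free variables and every other entry of the superfrieze is written as a (rational) function of them. Then the supercommutative superalgebra generated by all the entries of the superfrieze is a subalgebra of the cluster superalgebra $\mathcal C_{\mathbb K}(X|Y,\widetilde Q)$, where sequences of even mutations are subject to the restriction that no two mutations are in the same direction. Moreover, for $i=1,\dots,n$, the element $a_{1,i}$ equals $\mu_i\cdots\mu_1(x_i)$ (mutate first at $x_1$, then at $x_2$, ..., then at $x_i$), so it is a cluster variable.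
   Context: **Superfriezes.** Let $\mathcal R=\mathcal R_0\oplus\mathcal R_1$ be a supercommutative ring. A superfrieze of width $n$ over $\mathcal R$ is an infinite array of even elements $a_{i,j}\in\mathcal R_0$ ($i,j\in\mathbb Z$, $-2\le j-i\le n+1$) and odd elements $\beta_{i,j}\in\mathcal R_1$ ($i,j$ both in $\mathbb Z$ or both in $\frac12+\mathbb Z$, $-1\le j-i\le n+1$), with boundary rows $a_{i,i-2}=0$, $\beta_{i,i-1}=0$, $a_{i,i-1}=1$ at the top and $a_{i,i+n}=1$, $\beta_{i,i+n+1}=0$, $a_{i,i+n+1}=0$ at the bottom. The array is drawn so that rows are indexed by $j-i$, with odd and even rows alternating. Every elementary diamond $$\begin{array}{ccccc} & & B & & \\ & \alpha & & \beta & \\ A & & & & D \\ & \gamma & & \delta & \\ & & C & & \end{array}$$ with $A=a_{i,j}$, $B=a_{i+1,j}$, $C=a_{i,j+1}$, $D=a_{i+1,j+1}$, $\alpha=\beta_{i+\frac12,j+\frac12}$, $\beta=\beta_{i+1,j+1}$, $\gamma=\beta_{i,j+1}$, $\delta=\beta_{i+\frac12,j+\frac32}$ (for $i,j\in\mathbb Z$, $-1\le j-i\le n$) satisfies $$AD-BC=1+\delta\alpha,\qquad B\gamma-A\beta=\alpha,\qquad B\delta-D\alpha=\beta,$$ and also $A\delta-C\alpha=\gamma$ (a consequence of the others when $B$ is not a zero-divisor; for the top diamonds, where $B=0$, it says $\beta_{i,i}=\beta_{i+\frac12,i+\frac12}$). The entries of the generic superfrieze of the claim lie in $\mathbb K(x_1,\dots,x_n)\otimes\mathbb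 K[y_1,\dots,y_{n+1}]$, with $\mathbb K[y_1,\dots,y_{n+1}]$ the Grassmann (exterior) algebra. **Superquivers and seeds.** A superquiver is a finite quiver with even and odd vertices, without $2$-cycles between two even vertices or between two odd vertices and without loops at even vertices (loops at odd vertices and $2$-cycles between an even and an odd vertex are allowed). A seed $(X|Y,Q)$ consists of even variables $X=\{x_1,\dots,x_m\}$ (commuting with everything), odd variables $Y$ (anticommuting with each other), and a superquiver $Q$ whose vertices are labeled by them. Here all variables are mutable. Below $x_i,y_j$ denote the variables of the current seed; empty products are $1$, empty sums are $0$, and products over arrows are with multiplicity. **Even mutation** $\mu_k$ at an even vertex $x_k$: all variables other than $x_k$ are unchanged and $$\mu_k(x_k)=\frac1{x_k}\Big[(-1)^u\prod_{x_i\to x_k}x_i+(-1)^v\prod_{x_k\to x_j}x_j+\sum y_iy_j\Big],$$ where $u$ is the number of loops on odd vertices adjacent to even vertices $x_i$ with $x_i\to x_k$ ($a$ arrows $x_i\to x_k$, $b$ arrows between $y_j$ and $x_i$, $c$ loops on $y_j$ contribute $abc$), $v$ is defined likewise using arrows $x_k\to x_j$, and the last sum is over ordered pairs $(i,j)$, $i\neq j$, with a path $y_i\to x_k\to y_j$ and no arrow $y_i\to y_j$ ($a$ arrows $y_i\to x_k$ and $b$ arrows $x_k\to y_j$ contribute $ab\,y_iy_j$). The superquiver $\mu_k(Q)$: add an arrow $x_i\to x_j$ for each path $x_i\to x_k\to x_j$ of even vertices; reverse all arrows joining $x_k$ to even vertices; delete all $2$-cycles created between even vertices. All other arrows are unchanged.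 **Odd mutation** $\eta_i$ at an odd vertex $y_i$: all variables other than $y_i$ are unchanged and $$\eta_i(y_i)=\delta(y_i)y_i+\Big(\prod_{x_k\leftrightarrows y_i}\frac1{x_k}\Big)\Big[\Big(\sum_{y_i\to y_j}y_j\Big)P_{out}+\Big(\sum_{y_j\to y_i}y_j\Big)P_{in}\Big],$$ where $\delta(y_i)=1$ if there is no arrow between $y_i$ and another odd vertex and $\delta(y_i)=0$ otherwise; in the first product $x_k$ has multiplicity $ab$ if there are $a$ arrows $x_k\to y_i$ and $b$ arrows $y_i\to x_k$; $P_{out}$ is the product of the $x_l$ over configurations consisting of a path $y_i\to x_l\to y_j$ and an arrow $y_i\to y_j$, and $P_{in}$ the product of the $x_l$ over configurations consisting of a path $y_j\to x_l\to y_i$ and an arrow $y_j\to y_i$ (with multiplicity the product of the three numbers of arrows); the two sums and $P_{in}$ only involve $j\neq i$. The superquiver $\eta_i(Q)$: add an arrow $y_k\to y_j$ for each path $y_k\to y_i\to y_j$ with $k\ne i\ne j$; reverse all arrows incident to $y_i$; delete all $2$-cycles created between odd vertices. (In $\widetilde Q$ there are no arrows between odd vertices, so odd mutations do not change the odd variables.) **Cluster superalgebra.** $\mathcal C_{\mathbb K}(X|Y,\widetilde Q)$ is the supercommutative $\mathbb K$-superalgebra generated by $\mathcal X_{even}\cup\mathcal X_{odd}$, where $\mathcal X_{even}$ is the set of all even variables obtained from the initial seed by (possibly empty) sequences of even mutations in which no two mutations are in the same direction, and $\mathcal X_{odd}$ is the set of all odd variables obtained from the initial seed by finite sequences of odd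 mutations. *)

(* Defs.v *)
From HB Require Import structures.
From mathcomp Require Import all_boot all_order all_algebra falgebra.
From mathcomp Require Import mpoly.

Set Implicit Arguments.
Unset Strict Implicit.
Unset Printing Implicit Defensive.

Import GRing.Theory.
Local Open Scope ring_scope.

(* A supercommutative structure on R: [hpart false] is the even part R_0 and
   [hpart true] the odd part R_1. *)
Record supercommutative (R : pzRingType) := Supercommutative {
  hpart : bool -> {pred R};
  hpart_zmod : forall p, zmod_closed (hpart p);
  hpart_span : forall x, exists x0 x1,
    [/\ x0 \in hpart false, x1 \in hpart true & x = x0 + x1];
  hpart_direct : forall x, x \in hpart false -> x \in hpart true -> x = 0;
  hpart1 : 1 \in hpart false;
  hpartM : forall p q x y,
    x \in hpart p -> y \in hpart q -> x * y \in hpart (p (+) q);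
  supermulC : forall p q x y,
    x \in hpart p -> y \in hpart q -> x * y = (-1) ^+ (p && q) * (y * x)
}.

Definition even_el (R : pzRingType) (G : supercommutative R) := hpart G false.
Definition odd_el (R : pzRingType) (G : supercommutative R) := hpart G true.

Section HpartTheory.
Variables (R : unitRingType) (G : supercommutative R).

Lemma hpart0 p : 0 \in hpart G p.
Proof. by case: (hpart_zmod G p). Qed.

Lemma hpartB p x y : x \in hpart G p -> y \in hpart G p -> x - y \in hpart G p.
Proof. by case: (hpart_zmod G p) => _; apply. Qed.

Lemma hpartN p x : x \in hpart G p -> - x \in hpart G p.
Proof. by rewrite -sub0r; apply: hpartB; apply: hpart0. Qed.

Lemma hpartD p x y : x \in hpart G p -> y \in hpart G p -> x + y \in hpart G p.
Proof. by move=> hx hy; rewrite -[y]opprK; apply: hpartB => //; apply: hpartN. Qed.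

Lemma hpart_sum p I (r : seq I) (P : pred I) (f : I -> R) :
  (forall i, P i -> f i \in hpart G p) -> \sum_(i <- r | P i) f i \in hpart G p.
Proof.
move=> h; elim/big_rec: _ => [|i x Pi hx]; first exact: hpart0.
by apply: hpartD => //; apply: h.
Qed.

Lemma hpartMn p x m : x \in hpart G p -> x *+ m \in hpart G p.
Proof.
by move=> hx; elim: m => [|m IH]; rewrite ?mulr0n ?hpart0 // mulrS hpartD.
Qed.

Lemma even_elM x y : x \in even_el G -> y \in even_el G -> x * y \in even_el G.
Proof. exact: hpartM. Qed.

Lemma even_elX x m : x \in even_el G -> x ^+ m \in even_el G.
Proof.
move=> hx; elim: m => [|m IH]; first by rewrite expr0; apply: hpart1.
by rewrite exprS; apply: even_elM.
Qed.

Lemma even_el_prod I (r : seq I) (P : pred I) (f : I -> R) :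
  (forall i, P i -> f i \in even_el G) -> \prod_(i <- r | P i) f i \in even_el G.
Proof.
move=> h; elim/big_rec: _ => [|i x Pi hx]; first exact: hpart1.
by apply: even_elM => //; apply: h.
Qed.

Lemma even_el_sign m : (-1) ^+ m \in even_el G.
Proof. by apply/even_elX/hpartN/hpart1. Qed.

Lemma even_elV x : x \in even_el G -> x^-1 \in even_el G.
Proof.
move=> hx; case ux : (x \is a GRing.unit); last by rewrite invr_out ?ux.
have [u [v [hu hv e]]] := hpart_span G x^-1.
have hxu : x * u \in hpart G false by exact: (hpartM hx hu).
have hxv : x * v \in hpart G true by exact: (hpartM hx hv).
have e1 : x * u + x * v = 1 by rewrite -mulrDr -e divrr.
have xv0 : x * v = 0.
  apply: (hpart_direct (s := G)) => //.
  have -> : x * v = 1 - x * u by rewrite -e1 addrC addKr.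
  by apply: hpartB => //; apply: hpart1.
have v0 : v = 0 by rewrite -(mulKr ux v) xv0 mulr0.
by rewrite e v0 addr0.
Qed.

End HpartTheory.

Section Grassmann.
Variables (F : fieldType) (m : nat).

(* The Grassmann algebra on m odd generators over F: the element f is
   \sum_S f S *: e_S, where e_S is the product of the generators of indices in
   S in increasing order. *)
Definition grassmann := {ffun {set 'I_m} -> F}.

HB.instance Definition _ := Vector.copy grassmann {ffun {set 'I_m} -> F^o}.

Implicit Types (A B C S T : {set 'I_m}) (f g h : grassmann).

Definition inversions A B : nat := \sum_(i in A) \sum_(j in B) (j < i)%N.

(* For disjoint A and B, e_A * e_B = (-1)^(inversions A B) e_(A :|: B). *)
Definition gr_mul f g : grassmann :=
  [ffun S => \sum_(A : {set 'I_m})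
     \sum_(B : {set 'I_m} | [disjoint A & B] && (A :|: B == S))
       (-1) ^+ inversions A B * (f A * g B)].

Definition gr_one : grassmann := [ffun S => (S == set0)%:R].

Let coef A B S : F :=
  if [disjoint A & B] && (A :|: B == S) then (-1) ^+ inversions A B else 0.

Let mulE f g S : gr_mul f g S = \sum_A \sum_B coef A B S * (f A * g B).
Proof.
rewrite ffunE; apply: eq_bigr => A _; rewrite big_mkcond /=.
by apply: eq_bigr => B _; rewrite /coef; case: ifP; rewrite ?mul0r.
Qed.

Let sumU A B (c : 'I_m -> nat) : [disjoint A & B] ->
  (\sum_(i in A :|: B) c i = \sum_(i in A) c i + \sum_(i in B) c i)%N.
Proof.
by move=> dAB; rewrite -bigU //; apply: eq_bigl => i; rewrite !inE.
Qed.

Lemma inversionsUl A B C : [disjoint A & B] ->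
  inversions (A :|: B) C = (inversions A C + inversions B C)%N.
Proof. exact: sumU. Qed.

Lemma inversionsUr A B C : [disjoint B & C] ->
  inversions A (B :|: C) = (inversions A B + inversions A C)%N.
Proof.
move=> dBC; rewrite /inversions -big_split; apply: eq_bigr => i _ /=.
exact: sumU.
Qed.

Let coefA A B C S :
  \sum_T coef A B T * coef T C S = \sum_T coef B C T * coef A T S.
Proof.
rewrite (bigD1 (A :|: B)) //= big1 ?addr0 => [|T nT]; last first.
  by rewrite /coef (eq_sym (A :|: B)) (negbTE nT) andbF mul0r.
rewrite (bigD1 (B :|: C)) //= big1 ?addr0 => [|T nT]; last first.
  by rewrite /coef (eq_sym (B :|: C)) (negbTE nT) andbF mul0r.
rewrite /coef !eqxx !andbT setUA.
have dU : [disjoint A :|: B & C] = [disjoint A & C] && [disjoint B & C].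
  by rewrite -!setI_eq0 setIUl setU_eq0.
have dU' : [disjoint A & B :|: C] = [disjoint A & B] && [disjoint A & C].
  by rewrite -!setI_eq0 setIUr setU_eq0.
rewrite dU dU'.
have [dAB|_] := boolP [disjoint A & B]; last by rewrite mul0r !andFb mulr0.
have [dBC|_] := boolP [disjoint B & C]; last by rewrite andbF andFb mulr0 mul0r.
rewrite andbT /=; case: ifP => _; last by rewrite !mulr0.
by rewrite -!exprD inversionsUl // inversionsUr // addnA addnC addnA.
Qed.

Let mulA : associative gr_mul.
Proof.
move=> f g h; apply/ffunP => S; rewrite !mulE.
transitivity (\sum_A \sum_B \sum_C
    (\sum_T coef B C T * coef A T S) * (f A * g B * h C)).
  apply: eq_bigr => A _.
  under eq_bigr => T _.
    rewrite mulE !mulr_sumr.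
    under eq_bigr do rewrite !mulr_sumr.
    over.
  rewrite exchange_big /=; apply: eq_bigr => B _.
  rewrite exchange_big /=; apply: eq_bigr => C _.
  rewrite mulr_suml; apply: eq_bigr => T _.
  by rewrite [f A * _]mulrCA [LHS]mulrCA !mulrA.
under eq_bigr do under eq_bigr do under eq_bigr do rewrite -coefA.
apply: esym.
transitivity (\sum_T \sum_C \sum_A \sum_B
    coef A B T * coef T C S * (f A * g B * h C)).
  apply: eq_bigr => T _; apply: eq_bigr => C _.
  rewrite mulE mulr_suml mulr_sumr; apply: eq_bigr => A _.
  rewrite mulr_suml mulr_sumr; apply: eq_bigr => B _.
  by rewrite -!mulrA mulrCA.
rewrite exchange_big /= (eq_bigr (fun C => \sum_A \sum_B \sum_T
    coef A B T * coef T C S * (f A * g B * h C))); last first.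
  move=> C _; rewrite exchange_big /=; apply: eq_bigr => A _.
  by rewrite exchange_big.
rewrite exchange_big /=; apply: eq_bigr => A _.
rewrite exchange_big /=; apply: eq_bigr => B _; apply: eq_bigr => C _.
by rewrite mulr_suml.
Qed.

Let coef0l B S : coef set0 B S = (B == S)%:R.
Proof.
rewrite /coef set0U -setI_eq0 set0I eqxx /inversions big_set0 expr0 /=.
by case: eqP.
Qed.

Let coef0r B S : coef B set0 S = (B == S)%:R.
Proof.
rewrite /coef setU0 -setI_eq0 setI0 eqxx /inversions /=.
rewrite big1 ?expr0 => [|i _]; last by rewrite big_set0.
by case: eqP.
Qed.

Let mul1 : left_id gr_one gr_mul.
Proof.
move=> f; apply/ffunP => S; rewrite mulE (bigD1 set0) //= [X in _ + X]big1.
  rewrite (bigD1 S) //= [X in _ + X + _]big1 => [|B nB].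
    by rewrite coef0l ffunE !eqxx !mul1r !addr0.
  by rewrite coef0l (negbTE nB) mul0r.
move=> A nA; apply: big1 => B _.
by rewrite ffunE (negbTE nA) mul0r mulr0.
Qed.

Let mulr1' : right_id gr_one gr_mul.
Proof.
move=> f; apply/ffunP => S; rewrite mulE (bigD1 S) //= [X in _ + X]big1.
  rewrite (bigD1 set0) //= [X in _ + X + _]big1 => [|B nB].
    by rewrite coef0r ffunE !eqxx mul1r mulr1 !addr0.
  by rewrite ffunE (negbTE nB) !mulr0.
move=> A nA; apply: big1 => B _; rewrite ffunE.
have [->|nB] := eqVneq B set0; last by rewrite !mulr0.
by rewrite coef0r (negbTE nA) mul0r.
Qed.

Let mulDl : left_distributive gr_mul +%R.
Proof.
move=> f g h; apply/ffunP => S; rewrite [RHS]ffunE !mulE -big_split.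
apply: eq_bigr => A _; rewrite -big_split; apply: eq_bigr => B _ /=.
by rewrite ffunE mulrDl mulrDr.
Qed.

Let mulDr : right_distributive gr_mul +%R.
Proof.
move=> f g h; apply/ffunP => S; rewrite [RHS]ffunE !mulE -big_split.
apply: eq_bigr => A _; rewrite -big_split; apply: eq_bigr => B _ /=.
by rewrite ffunE !mulrDr.
Qed.

Let one_neq0 : gr_one != 0.
Proof.
apply/eqP => /ffunP/(_ set0); rewrite !ffunE eqxx => /eqP.
by rewrite oner_eq0.
Qed.

HB.instance Definition _ := GRing.Zmodule_isNzRing.Build grassmann
  mulA mul1 mulr1' mulDl mulDr one_neq0.

Let scaleAl (a : F) f g : a *: (f * g) = a *: f * g.
Proof.
apply/ffunP => S; rewrite ffunE [in RHS]mulE [in LHS]mulE.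
change (a * (\sum_A \sum_B coef A B S * (f A * g B)) =
  \sum_A \sum_B coef A B S * ((a *: f) A * g B)).
rewrite mulr_sumr; apply: eq_bigr => A _; rewrite mulr_sumr.
by apply: eq_bigr => B _; rewrite ffunE mulrCA -(mulrA a).
Qed.

HB.instance Definition _ := GRing.Lmodule_isLalgebra.Build F grassmann scaleAl.

Let scaleAr (a : F) f g : a *: (f * g) = f * (a *: g).
Proof.
apply/ffunP => S; rewrite ffunE [in RHS]mulE [in LHS]mulE.
change (a * (\sum_A \sum_B coef A B S * (f A * g B)) =
  \sum_A \sum_B coef A B S * (f A * (a *: g) B)).
rewrite mulr_sumr; apply: eq_bigr => A _; rewrite mulr_sumr.
by apply: eq_bigr => B _; rewrite ffunE mulrCA (mulrCA a).
Qed.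

HB.instance Definition _ := GRing.Lalgebra_isAlgebra.Build F grassmann scaleAr.

(* This provides the unitRingType structure: x^-1 is the inverse of x if x is
   invertible, and x otherwise. *)
HB.instance Definition _ := Algebra_isFalgebra.Build F grassmann.

Definition gr_gen (i : 'I_m) : grassmann := [ffun S => (S == [set i])%:R].

Definition gr_hpart (p : bool) : {pred grassmann} :=
  [pred f : grassmann | [forall S : {set 'I_m}, (f S != 0) ==> (odd #|S| == p)]].

Let hpartP p f :
  reflect (forall S, odd #|S| != p -> f S = 0) (f \in gr_hpart p).
Proof.
apply: (iffP forallP) => h S.
  by move=> nS; apply/eqP; apply: contraNT nS => fS; apply: (implyP (h S)).
by apply/implyP; apply: contraNT => /h ->.
Qed.

Let gr_zmod p : zmod_closed (gr_hpart p).
Proof.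
split=> [|f g /hpartP hf /hpartP hg]; apply/hpartP => S nS; rewrite !ffunE //.
by rewrite hf // hg // subr0.
Qed.

Let gr_span f : exists f0 f1,
  [/\ f0 \in gr_hpart false, f1 \in gr_hpart true & f = f0 + f1].
Proof.
exists [ffun S : {set 'I_m} => if odd #|S| then 0 else f S].
exists [ffun S : {set 'I_m} => if odd #|S| then f S else 0].
split; [apply/hpartP=> S | apply/hpartP=> S | apply/ffunP=> S];
  rewrite !ffunE; by case: odd; rewrite ?add0r ?addr0.
Qed.

Let gr_direct f : f \in gr_hpart false -> f \in gr_hpart true -> f = 0.
Proof.
move=> /hpartP h0 /hpartP h1; apply/ffunP => S; rewrite ffunE.
by case oS : (odd #|S|); [apply: h0 | apply: h1]; rewrite oS.
Qed.

Let gr_hpart1 : (1 : grassmann) \in gr_hpart false.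
Proof.
apply/hpartP => S; rewrite ffunE; have [->|] := eqVneq S set0 => //.
by rewrite cards0.
Qed.

Let cardU A B : [disjoint A & B] -> #|A :|: B| = (#|A| + #|B|)%N.
Proof. by move=> d; rewrite cardsU disjoint_setI0 // cards0 subn0. Qed.

Let gr_hpartM p q f g :
  f \in gr_hpart p -> g \in gr_hpart q -> f * g \in gr_hpart (p (+) q).
Proof.
move=> /hpartP hf /hpartP hg; apply/hpartP => S nS.
rewrite [LHS]ffunE; apply: big1 => A _; apply: big1 => B /andP[dAB /eqP eS].
have [oA|oA] := eqVneq (odd #|A|) p; last by rewrite hf // mul0r mulr0.
have [oB|oB] := eqVneq (odd #|B|) q; last by rewrite hg // !mulr0.
by move: nS; rewrite -eS cardU // oddD oA oB eqxx.
Qed.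

Let inversionsC A B : [disjoint A & B] ->
  (inversions A B + inversions B A = #|A| * #|B|)%N.
Proof.
move=> dAB; rewrite /inversions [X in (_ + X)%N]exchange_big /= -big_split /=.
rewrite -sum_nat_const; apply: eq_bigr => i iA.
rewrite -big_split /= -sum1_card; apply: eq_bigr => j jB.
have: i != j by apply: contraTneq jB => <-; rewrite (disjointFr dAB).
by rewrite -val_eqE /=; case: ltngtP.
Qed.

Let gr_supermulC p q f g : f \in gr_hpart p -> g \in gr_hpart q ->
  f * g = (-1) ^+ (p && q) * (g * f).
Proof.
move=> /hpartP hf /hpartP hg; apply/ffunP => S.
have -> : ((-1) ^+ (p && q) * (g * f)) S = (-1) ^+ (p && q) * (g * f) S.
  by case: (p && q); rewrite ?expr0 ?expr1 ?mul1r // !mulN1r ffunE.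
rewrite [LHS]ffunE [in RHS]ffunE big_mkcond.
rewrite [in RHS](exchange_big_dep xpredT) //= mulr_sumr.
apply: eq_bigr => A _; rewrite mulr_sumr; apply: eq_big => [B|B].
  by rewrite disjoint_sym setUC.
move=> /andP[dAB _].
have [oA|oA] := eqVneq (odd #|A|) p; last by rewrite hf // !(mul0r, mulr0).
have [oB|oB] := eqVneq (odd #|B|) q; last by rewrite hg // !(mul0r, mulr0).
rewrite [g B * _]mulrC mulrA; congr (_ * _).
rewrite -oA -oB -oddM -inversionsC // signr_odd exprD -mulrA -exprD.
by rewrite addnn -mul2n exprM sqrrN !expr1n mulr1.
Qed.

Definition gr_super : supercommutative grassmann :=
  Supercommutative gr_zmod gr_span gr_direct gr_hpart1 gr_hpartM gr_supermulC.

Lemma gr_gen_odd i : gr_gen i \in odd_el gr_super.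
Proof.
apply/hpartP => S oS; rewrite ffunE; have [e|//] := eqVneq S [set i].
by rewrite e cards1 in oS.
Qed.

Lemma gr_scalar_even (c : F) : c%:A \in even_el gr_super.
Proof.
apply/hpartP => S oS; rewrite ffunE /= [X in _ *: X]ffunE.
by have [e|_] := eqVneq S set0; [rewrite e cards0 in oS | rewrite scaler0].
Qed.

End Grassmann.

Section Superfrieze.
Variables (R : pzRingType) (G : supercommutative R) (n : nat).

(* [sf_a i j] is a_(i,j), [sf_b i j] is beta_(i,j) and [sf_h i j] is
   beta_(i+1/2,j+1/2), for i and j integers; values outside of the ranges of
   j - i below are irrelevant. *)
Record superfrieze := Superfrieze {
  sf_a : int -> int -> R;
  sf_b : int -> int -> R;
  sf_h : int -> int -> R;
  sf_a_even : forall i j : int, -2 <= j - i <= n%:Z + 1 -> sf_a i j \in even_el G;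
  sf_b_odd : forall i j : int, -1 <= j - i <= n%:Z + 1 -> sf_b i j \in odd_el G;
  sf_h_odd : forall i j : int, -1 <= j - i <= n%:Z + 1 -> sf_h i j \in odd_el G;
  sf_a_top0 : forall i, sf_a i (i - 2) = 0;
  sf_b_top : forall i, sf_b i (i - 1) = 0;
  sf_h_top : forall i, sf_h i (i - 1) = 0;
  sf_a_top1 : forall i, sf_a i (i - 1) = 1;
  sf_a_bot1 : forall i, sf_a i (i + n%:Z) = 1;
  sf_b_bot : forall i, sf_b i (i + n%:Z + 1) = 0;
  sf_h_bot : forall i, sf_h i (i + n%:Z + 1) = 0;
  sf_a_bot0 : forall i, sf_a i (i + n%:Z + 1) = 0;
  sf_diamond : forall i j : int, -1 <= j - i <= n%:Z ->
    let A := sf_a i j in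
    let B := sf_a (i + 1) j in
    let C := sf_a i (j + 1) in
    let D := sf_a (i + 1) (j + 1) in
    let alpha := sf_h i j in
    let beta := sf_b (i + 1) (j + 1) in
    let gamma := sf_b i (j + 1) in
    let delta := sf_h i (j + 1) in
    [/\ A * D - B * C = 1 + delta * alpha,
        B * gamma - A * beta = alpha,
        B * delta - D * alpha = beta &
        A * delta - C * alpha = gamma]
}.

Definition sf_entry (s : superfrieze) (z : R) : Prop :=
  exists i j : int,
    (-2 <= j - i <= n%:Z + 1 /\ z = sf_a s i j) \/
    (-1 <= j - i <= n%:Z + 1 /\ (z = sf_b s i j \/ z = sf_h s i j)).

End Superfrieze.

(* The p even vertices are the [inl i], the q odd ones the [inr j], and
   [arrows v w] is the number of arrows v -> w. *)
Record superquiver (p q : nat) := Superquiver {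
  arrows : 'I_p + 'I_q -> 'I_p + 'I_q -> nat;
  no_even_loop : forall i, arrows (inl i) (inl i) = 0%N;
  no_even_2cycle : forall i j,
    arrows (inl i) (inl j) = 0%N \/ arrows (inl j) (inl i) = 0%N;
  no_odd_2cycle : forall i j, i != j ->
    arrows (inr i) (inr j) = 0%N \/ arrows (inr j) (inr i) = 0%N
}.

Lemma subn_asym (a b : nat) : ((a - b)%N = 0 \/ (b - a)%N = 0)%N.
Proof. by case: (leqP a b) => [|/ltnW] h; [left | right]; apply/eqP. Qed.

Section QuiverMutation.
Variables (p q : nat).

Section Even.
Variables (k : 'I_p) (Q : superquiver p q).

Local Notation ar := (arrows Q).

Let even_step (i j : 'I_p) : nat :=
  if (i == k) || (j == k) then ar (inl j) (inl i)
  else (ar (inl i) (inl j) + ar (inl i) (inl k) * ar (inl k) (inl j))%N.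

(* Deleting the 2-cycles i -> j -> i leaves, by truncated subtraction, the
   excess of arrows i -> j over arrows j -> i. *)
Definition even_mut_arrows (v w : 'I_p + 'I_q) : nat :=
  match v, w with
  | inl i, inl j => (even_step i j - even_step j i)%N
  | _, _ => ar v w
  end.

Let even_loop i : even_mut_arrows (inl i) (inl i) = 0%N.
Proof. by rewrite /= subnn. Qed.

Let even_2cycle i j :
  even_mut_arrows (inl i) (inl j) = 0%N \/ even_mut_arrows (inl j) (inl i) = 0%N.
Proof. exact: subn_asym. Qed.

Definition even_mut_quiver : superquiver p q :=
  @Superquiver _ _ even_mut_arrows even_loop even_2cycle (@no_odd_2cycle _ _ Q).

End Even.

Section Odd.
Variables (k : 'I_q) (Q : superquiver p q).

Local Notation ar := (arrows Q).

Let odd_step (i j : 'I_q) : nat :=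
  if (i == k) || (j == k) then ar (inr j) (inr i)
  else (ar (inr i) (inr j) + ar (inr i) (inr k) * ar (inr k) (inr j))%N.

(* The test i == j keeps the loops, which are not 2-cycles. *)
Definition odd_mut_arrows (v w : 'I_p + 'I_q) : nat :=
  match v, w with
  | inr i, inr j =>
      if i == j then odd_step i i else (odd_step i j - odd_step j i)%N
  | inl _, inr j => if j == k then ar w v else ar v w
  | inr i, inl _ => if i == k then ar w v else ar v w
  | inl _, inl _ => ar v w
  end.

Let odd_2cycle i j : i != j ->
  odd_mut_arrows (inr i) (inr j) = 0%N \/ odd_mut_arrows (inr j) (inr i) = 0%N.
Proof.
by move=> /negbTE ne; rewrite /= ne eq_sym ne; apply: subn_asym.
Qed.

Definition odd_mut_quiver : superquiver p q :=
  @Superquiver _ _ odd_mut_arrows (@no_even_loop _ _ Q) (@no_even_2cycle _ _ Q)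
    odd_2cycle.

End Odd.
End QuiverMutation.

Record seed (R : unitRingType) (G : supercommutative R) (p q : nat) := Seed {
  even_var : 'I_p -> R;
  odd_var : 'I_q -> R;
  quiver : superquiver p q;
  even_varP : forall i, even_var i \in even_el G;
  odd_varP : forall j, odd_var j \in odd_el G
}.

Section SeedMutation.
Variables (R : unitRingType) (G : supercommutative R) (p q : nat).

Section Even.
Variables (k : 'I_p) (s : seed G p q).

Local Notation ar := (arrows (quiver s)).
Local Notation x := (even_var s).
Local Notation y := (odd_var s).

(* The number c of loops at y_j, counted b times for each even vertex x_i,
   where b is the number of arrows, in any direction, between x_i and y_j. *)
Definition loops_near (i : 'I_p) : nat :=
  (\sum_(j < q) (ar (inl i) (inr j) + ar (inr j) (inl i)) * ar (inr j) (inr j))%N.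

Definition u_exp : nat := (\sum_(i < p) ar (inl i) (inl k) * loops_near i)%N.
Definition v_exp : nat := (\sum_(i < p) ar (inl k) (inl i) * loops_near i)%N.

Definition even_mut_var : R :=
  (x k)^-1 *
  ((-1) ^+ u_exp * \prod_(i < p) x i ^+ ar (inl i) (inl k)
   + (-1) ^+ v_exp * \prod_(j < p) x j ^+ ar (inl k) (inl j)
   + \sum_(i < q) \sum_(j < q | (i != j) && (ar (inr i) (inr j) == 0%N))
       (y i * y j) *+ (ar (inr i) (inl k) * ar (inl k) (inr j))).

Let even_mut_varP i : (if i == k then even_mut_var else x i) \in even_el G.
Proof.
case: ifP => _; last exact: even_varP.
apply/even_elM/hpartD/hpart_sum => [||i' _].
- exact/even_elV/even_varP.
- apply: hpartD; apply: even_elM; rewrite ?even_el_sign //;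
    apply: even_el_prod => j _; exact/even_elX/even_varP.
- apply: hpart_sum => j _; apply: hpartMn.
  exact: (hpartM (odd_varP s i') (odd_varP s j)).
Qed.

Definition even_mut : seed G p q :=
  Seed (even_var := fun i => if i == k then even_mut_var else x i) (odd_var := y)
    (even_mut_quiver k (quiver s)) even_mut_varP (odd_varP s).

End Even.

Section Odd.
Variables (k : 'I_q) (s : seed G p q).

Local Notation ar := (arrows (quiver s)).
Local Notation x := (even_var s).
Local Notation y := (odd_var s).

Definition odd_isolated : bool :=
  [forall (j | j != k), (ar (inr k) (inr j) == 0%N) && (ar (inr j) (inr k) == 0%N)].

(* j = k is allowed in P_out, but neither in P_in nor in the two sums. *)
Definition P_out : R :=
  \prod_(l < p) \prod_(j < q)
    x l ^+ (ar (inr k) (inl l) * ar (inl l) (inr j) * ar (inr k) (inr j)).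

Definition P_in : R :=
  \prod_(l < p) \prod_(j < q | j != k)
    x l ^+ (ar (inr j) (inl l) * ar (inl l) (inr k) * ar (inr j) (inr k)).

Definition odd_mut_var : R :=
  y k *+ odd_isolated
  + \prod_(l < p) (x l)^-1 ^+ (ar (inl l) (inr k) * ar (inr k) (inl l))
    * ((\sum_(j < q | j != k) y j *+ ar (inr k) (inr j)) * P_out
       + (\sum_(j < q | j != k) y j *+ ar (inr j) (inr k)) * P_in).

Let odd_mut_varP j : (if j == k then odd_mut_var else y j) \in odd_el G.
Proof.
case: ifP => _; last exact: odd_varP.
have hs (f : 'I_q -> nat) : \sum_(j0 < q | j0 != k) y j0 *+ f j0 \in odd_el G.
  by apply: hpart_sum => i _; apply/hpartMn/odd_varP.
have ho : P_out \in even_el G.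
  by do 2!(apply: even_el_prod => ? _); apply/even_elX/even_varP.
have hi : P_in \in even_el G.
  by do 2!(apply: even_el_prod => ? _); apply/even_elX/even_varP.
apply: hpartD; first exact/hpartMn/odd_varP.
apply: (hpartM (p := false) (q := true)).
  by apply: even_el_prod => l _; apply/even_elX/even_elV/even_varP.
by apply: hpartD; [exact: (hpartM (hs _) ho) | exact: (hpartM (hs _) hi)].
Qed.

Definition odd_mut : seed G p q :=
  Seed (even_var := x) (odd_var := fun j => if j == k then odd_mut_var else y j)
    (odd_mut_quiver k (quiver s)) (even_varP s) odd_mut_varP.

End Odd.

(* The head of the list is the first mutation performed. *)
Definition even_muts (s : seed G p q) (ks : seq 'I_p) : seed G p q :=
  foldl (fun s' k => even_mut k s') s ks.

Definition odd_muts (s : seed G p q) (ks : seq 'I_q) : seed G p q :=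
  foldl (fun s' k => odd_mut k s') s ks.

Definition even_cluster_var (s : seed G p q) (z : R) : Prop :=
  exists2 ks : seq 'I_p, uniq ks & exists i, z = even_var (even_muts s ks) i.

Definition odd_cluster_var (s : seed G p q) (z : R) : Prop :=
  exists (ks : seq 'I_q) (j : 'I_q), z = odd_var (odd_muts s ks) j.

End SeedMutation.

(* The subalgebra generated by the subset S of R, where iota : K -> R is the
   structure map of the K-algebra R. *)
Inductive generated (K R : pzRingType) (iota : K -> R) (S : R -> Prop) : R -> Prop :=
| generated_mem z of S z : generated iota S z
| generated_scalar c : generated iota S (iota c)
| generated_add z w of generated iota S z & generated iota S w :
    generated iota S (z + w)
| generated_mul z w of generated iota S z & generated iota S w :
    generated iota S (z * w).

Definition cluster_superalgebra (K : pzRingType) (R : unitRingType)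
    (iota : K -> R) (G : supercommutative R) (p q : nat) (s : seed G p q) :
    R -> Prop :=
  generated iota (fun z => even_cluster_var s z \/ odd_cluster_var s z).

Section Qtilde.
Variable n : nat.

Definition Qtilde_arrows (v w : 'I_n + 'I_n.+1) : nat :=
  match v, w with
  | inl i, inl j => (j == i.+1 :> nat)
  | inl i, inr j => (j == i :> nat)
  | inr j, inl i => (j == i.+1 :> nat)
  | inr _, inr _ => 0%N
  end.

Let Qtilde_loop i : Qtilde_arrows (inl i) (inl i) = 0%N.
Proof. by rewrite /= ltn_eqF. Qed.

Let Qtilde_even_2cycle i j :
  Qtilde_arrows (inl i) (inl j) = 0%N \/ Qtilde_arrows (inl j) (inl i) = 0%N.
Proof.
rewrite /=; case: (eqVneq (j : nat) i.+1) => [->|]; [right | by left].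
by rewrite ltn_eqF // ltnW.
Qed.

Let Qtilde_odd_2cycle i j : i != j ->
  Qtilde_arrows (inr i) (inr j) = 0%N \/ Qtilde_arrows (inr j) (inr i) = 0%N.
Proof. by left. Qed.

Definition Qtilde : superquiver n n.+1 :=
  Superquiver Qtilde_loop Qtilde_even_2cycle Qtilde_odd_2cycle.

End Qtilde.

(* K(x_1,...,x_n) (x) K[y_1,...,y_(n+1)], the tensor product being over K. *)
Notation generic_ring K n := (grassmann {fraction {mpoly K[n]}} n.+1).

Section Generic.
Variables (K : fieldType) (n : nat).

Definition generic_super : supercommutative (generic_ring K n) :=
  gr_super {fraction {mpoly K[n]}} n.+1.

Definition generic_scalar (c : K) : generic_ring K n := (tofrac c%:MP_[n])%:A.

(* Indices start at 0: x_(i+1) is [generic_x i] and y_(j+1) is [generic_y j]. *)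
Definition generic_x (i : 'I_n) : generic_ring K n := (tofrac ('X_i : {mpoly K[n]}))%:A.

Definition generic_y (j : 'I_n.+1) : generic_ring K n := gr_gen _ j.

Definition generic_seed : seed generic_super n n.+1 :=
  Seed (even_var := generic_x) (odd_var := generic_y) (Qtilde n)
    (fun i => gr_scalar_even n.+1 (tofrac 'X_i)) (@gr_gen_odd _ _).

End Generic.

(* Main.v *)
Require Import Defs.
From HB Require Import structures.
From mathcomp Require Import all_boot all_order all_algebra falgebra.
From mathcomp Require Import mpoly.
From mathcomp Require Import zify ring.
Import Order.TTheory GRing.Theory.
Local Open Scope ring_scope.

(** Call the [i]-th diagonal of a superfrieze the family of the a_(i,j) and of
    the beta_(i+1/2,j+1/2), for varying j. Everything follows from a shift rule
    expressing a diagonal through the two preceding ones: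
      a_(i+2,j) = a_(i,i) a_(i+1,j) - a_(i,j) + beta_(i,i) beta_(i+1/2,j+1/2),
      beta_(i+3/2,j+1/2) = beta_(i+1/2,j+1/2) - beta_(i,i) a_(i+1,j)
    for i <= j <= i+n+1 ([sf_shift]; recall that beta_(i,i) =
    beta_(i+1/2,i+1/2)). Both sides satisfy the diamond relations, which
    determine a diagonal from the preceding one as soon as the entries of the
    latter are not zero divisors.

    At j = i+n+1 the boundary values turn the shift rule into
    a_(i,i) = a_(i+2,i+n+1) and beta_(i,i) = - beta_(i+3/2,i+n+3/2), so the rule
    can be run backwards as well as forwards. Hence a subring containing the
    a_(0,j), the a_(1,j) and the beta_(1/2,j+1/2) contains all the entries
    ([sf_entry_in]). In the cluster superalgebra the a_(0,j) and the
    beta_(1/2,j+1/2) are the initial variables, and the diamond relation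
    a_(0,k) a_(1,k+1) = 1 + a_(1,k) a_(0,k+1) + y_(k+2) y_(k+1) is exactly the
    exchange relation of the mutation at x_(k+1) following those at
    x_1, ..., x_k, because x_(k+1) is then a source among the even vertices,
    with arrows to its neighbours x_k and x_(k+2) ([even_muts_Qtilde]).

    It remains to see that no interior entry is a zero divisor. An element of
    a Grassmann algebra is regular once its body, i.e. its component of degree
    0, is nonzero ([gr_lreg]), and the bodies of the a_(i,j) form a Coxeter
    frieze over K(x_1, ..., x_n). In a Coxeter frieze the glide symmetry
    c_(i,j) = c_(j+2,i+n+1), a case of the Pluecker relation
    [frieze_plucker], carries the nonvanishing of the entries from one
    fundamental triangle to the next ones ([nz_triangle_all]). In the initial
    triangle the entries are 2x2 minors of the first two diagonals; clearing
    denominators gives explicit polynomials in the x_i, which take the value 1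
    or 2 at well-chosen points with coordinates 0 and 1
    ([bracket_num_neq0]). This is where the characteristic has to differ
    from 2: for n = 1 the body of a_(1,1) is 2/x_1. *)

(** * Integer indices *)

Lemma int_offset (i j : int) : i <= j -> exists t : nat, j = i + t%:Z.
Proof. by move=> ij; exists (absz (j - i)); lia. Qed.

Lemma int_two_way_ind (P : int -> Prop) (i0 : int) : P i0 ->
    (forall i, P i -> P (i + 1)) -> (forall i, P (i + 1) -> P i) ->
  forall i, P i.
Proof.
move=> P0 PS PP i.
have [/int_offset[t ->]|/ltW/int_offset[t e]] := leP i0 i.
  elim: t => [|t IH]; first by rewrite addr0.
  have -> : i0 + t.+1%:Z = i0 + t%:Z + 1 by lia.
  exact: PS.
elim: t i e => [|t IH] i e; first by rewrite (_ : i = i0) //; lia.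
by apply/PP/IH; lia.
Qed.

(** * Grassmann algebras *)

Section Body.
Variables (F : fieldType) (m : nat).
Implicit Types f g : grassmann F m.

Lemma gr_mulE f g (S : {set 'I_m}) :
  (f * g) S = \sum_(A : {set 'I_m})
    \sum_(B : {set 'I_m} | [disjoint A & B] && (A :|: B == S))
      (-1) ^+ inversions A B * (f A * g B).
Proof. exact: ffunE. Qed.

Lemma inversions0l (B : {set 'I_m}) : inversions set0 B = 0%N.
Proof. by rewrite /inversions big_set0. Qed.

Lemma gr_body1 : (1 : grassmann F m) set0 = 1.
Proof. by rewrite ffunE eqxx. Qed.

Lemma gr_bodyD f g : (f + g) set0 = f set0 + g set0.
Proof. exact: ffunE. Qed.

Lemma gr_bodyB f g : (f - g) set0 = f set0 - g set0.
Proof. by rewrite !ffunE. Qed.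

Lemma gr_bodyM f g : (f * g) set0 = f set0 * g set0.
Proof.
rewrite gr_mulE (bigD1 set0) //= [X in _ + X]big1 ?addr0 => [|A nA].
  rewrite (big_pred1 set0) ?inversions0l ?mul1r // => B.
  by rewrite set0U -setI_eq0 set0I eqxx.
rewrite big_pred0 // => B; rewrite setU_eq0 (negbTE nA) /= andbF //.
Qed.

Lemma gr_body_odd f : f \in odd_el (gr_super F m) -> f set0 = 0.
Proof.
move=> /forallP/(_ set0); rewrite cards0 /= implybF negbK.
by move/eqP.
Qed.

(** In a product with f, the component of degree k of the other factor g appears
    multiplied by the body of f, next to contributions of the components of g
    of smaller degree: if f * g = 0, these all vanish by induction on k. *)
Lemma gr_lreg f : f set0 != 0 -> GRing.lreg f.
Proof.
move=> f0 g h fgh; apply/eqP; rewrite -subr_eq0; apply/eqP.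
have: f * (g - h) = 0 by rewrite mulrBr fgh subrr.
move: (g - h) => {fgh h}g fg0; apply/ffunP => S; rewrite ffunE.
have [k] := ubnP #|S|; elim: k S => // k IH S ltSk.
have /ffunP/(_ S) := fg0; rewrite gr_mulE (bigD1 set0) //= [X in _ + X]big1.
  rewrite (big_pred1 S) => [|B].
    rewrite inversions0l mul1r ffunE addr0 => /eqP.
    by rewrite mulf_eq0 (negbTE f0) => /eqP.
  by rewrite set0U -setI_eq0 set0I eqxx.
move=> A nA; apply: big1 => B /andP[dAB /eqP eS].
rewrite IH ?mulr0 // -ltnS (leq_trans _ ltSk) // ltnS -eS cardsU.
rewrite disjoint_setI0 // cards0 subn0.
have: (0 < #|A|)%N by rewrite card_gt0.
lia.
Qed.

Lemma gr_odd_sqr f : (2%:R : F) != 0 -> f \in odd_el (gr_super F m) -> f * f = 0.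
Proof.
move=> two fodd; have := supermulC fodd fodd; rewrite /= expr1 mulN1r => e.
apply/ffunP => S; rewrite [RHS]ffunE.
have: (f * f) S + (f * f) S = 0 by rewrite {1}e ffunE addNr.
by move/eqP; rewrite -mulr2n -mulr_natl mulf_eq0 (negbTE two) => /eqP.
Qed.

End Body.

Section Central.
Variables (R : pzRingType) (G : supercommutative R).

Lemma even_el_comm x z : x \in even_el G -> x * z = z * x.
Proof.
move=> hx; have [z0 [z1 [h0 h1 ->]]] := hpart_span G z.
by rewrite mulrDl mulrDr (supermulC hx h0) (supermulC hx h1) !mul1r.
Qed.

Lemma odd_el_anticomm x y :
  x \in odd_el G -> y \in odd_el G -> x * y = - (y * x).
Proof. by move=> hx hy; rewrite (supermulC hx hy) expr1 mulN1r. Qed.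

End Central.

(** * Coxeter friezes *)

(** A Coxeter frieze of width n: rows indexed by j - i, bounded on each side by
    a row of 1 and a row of 0. As in a superfrieze, values outside of
    -2 <= j - i <= n + 1 are irrelevant. *)
Record coxeter_frieze (R : pzRingType) (n : nat) (c : int -> int -> R) : Prop :=
  CoxeterFrieze {
    cf_top0 : forall i, c i (i - 2) = 0;
    cf_top1 : forall i, c i (i - 1) = 1;
    cf_bot1 : forall i, c i (i + n%:Z) = 1;
    cf_bot0 : forall i, c i (i + n%:Z + 1) = 0;
    cf_rule : forall i j : int, -1 <= j - i <= n%:Z ->
      c i j * c (i + 1) (j + 1) - c (i + 1) j * c i (j + 1) = 1
  }.

Section CoxeterFrieze.
Variables (F : fieldType) (n : nat) (c : int -> int -> F).
Hypothesis cF : coxeter_frieze F n c.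

Let c_top0 := cf_top0 _ _ _ cF.
Let c_top1 := cf_top1 _ _ _ cF.
Let c_bot1 := cf_bot1 _ _ _ cF.
Let c_bot0 := cf_bot0 _ _ _ cF.
Let c_rule := cf_rule _ _ _ cF.

(** The entries in the triangle with vertices (i,i), (i,i+n) and (i+n,i+n) do
    not vanish. Apart from the boundary entry (i,i+n), it is a fundamental
    domain for the glide symmetry. *)
Definition nz_triangle (i : int) :=
  forall m j : int, i <= m -> m <= j -> j <= i + n%:Z -> c m j != 0.

(** The entries are 2x2 minors of the matrix whose rows are the diagonals i and
    i + 1. The diagonal m is determined by the diagonal m - 1 when the latter does
    not vanish, and the minors satisfy the frieze rule by the Pluecker relation. *)
Lemma frieze_plucker (i m j : int) :
    (forall m' j' : int, i + 1 <= m' -> m' < m -> m' <= j' -> j' <= i + n%:Z ->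
       c m' j' != 0) ->
    i + 1 <= m -> m - 1 <= j -> j <= i + n%:Z + 1 ->
  c m j = c i (m - 2) * c (i + 1) j - c i j * c (i + 1) (m - 2).
Proof.
move=> nz im; have [t e] := int_offset _ _ im; move: nz {im}; rewrite {m}e.
elim: t j => [|t IHt] j nz.
  have -> : i + 1 + 0%:Z - 2 = i - 1 by lia.
  rewrite c_top1; have -> : i - 1 = i + 1 - 2 by lia.
  by move=> _ _; rewrite c_top0 mul1r mulr0 !subr0.
move=> mj; have [r e] := int_offset _ _ mj; move: mj; rewrite {j}e.
elim: r => [|r IHr] _ jn.
  have -> : i + 1 + t.+1%:Z - 1 + 0%:Z = i + t%:Z + 1 by lia.
  have -> : i + 1 + t.+1%:Z - 2 = i + t%:Z by lia.
  rewrite [RHS](_ : _ = c i (i + t%:Z) * c (i + 1) (i + t%:Z + 1)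
    - c (i + 1) (i + t%:Z) * c i (i + t%:Z + 1)); last by ring.
  rewrite c_rule; last lia.
  by rewrite -(c_top1 (i + 1 + t.+1%:Z)); congr (c _ _); lia.
have jE : i + 1 + t.+1%:Z - 1 + r.+1%:Z = i + 1 + t%:Z + r%:Z + 1 by lia.
have mE : i + 1 + t.+1%:Z = i + 1 + t%:Z + 1 by lia.
have m2E : i + 1 + t.+1%:Z - 2 = i + t%:Z by lia.
have := IHr ltac:(lia) ltac:(lia).
have -> : i + 1 + t.+1%:Z - 1 + r%:Z = i + 1 + t%:Z + r%:Z by lia.
have Hj := IHt (i + 1 + t%:Z + r%:Z)
  (fun m' j' h1 h2 h3 h4 => nz m' j' h1 ltac:(lia) h3 h4) ltac:(lia) ltac:(lia).
have Hj1 := IHt (i + 1 + t%:Z + r%:Z + 1)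
  (fun m' j' h1 h2 h3 h4 => nz m' j' h1 ltac:(lia) h3 h4) ltac:(lia) ltac:(lia).
have u1 := c_rule (i + 1 + t%:Z) (i + 1 + t%:Z + r%:Z) ltac:(lia).
have u2 := c_rule i (i + 1 + t%:Z + r%:Z) ltac:(lia).
have := c_rule i (i + t%:Z - 1) ltac:(lia).
have nz0 : c (i + 1 + t%:Z) (i + 1 + t%:Z + r%:Z) != 0 by apply: nz; lia.
rewrite jE m2E mE in jn *; move: Hj Hj1 u1 u2 nz0.
have -> : i + 1 + t%:Z - 2 = i + t%:Z - 1 by lia.
have -> : i + t%:Z - 1 + 1 = i + t%:Z by lia.
set J := i + 1 + t%:Z + r%:Z; set M := i + 1 + t%:Z.
move: (c i J) (c i (J + 1)) (c (i + 1) J) (c (i + 1) (J + 1)) (c M J)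
  (c M (J + 1)) (c (M + 1) J) (c (M + 1) (J + 1)) (c i (i + t%:Z - 1))
  (c i (i + t%:Z)) (c (i + 1) (i + t%:Z - 1)) (c (i + 1) (i + t%:Z)).
(* p, q, cm and d are the diagonals i, i+1, m and m+1; the suffix 1 shifts j. *)
move=> p p1 q q1 cm cm1 d d1 pa pb qa qb Hj Hj1 u1 u2 nz0 u3 Hd.
apply: (mulfI nz0); apply: (addIr (- (d * cm1))); rewrite u1 Hd Hj Hj1.
rewrite [RHS](_ : _ = (pa * qb - qa * pb) * (p * q1 - q * p1)); last by ring.
by rewrite u2 u3 mul1r.
Qed.

(** Glide symmetry: the minor of [frieze_plucker] whose last column is (0, 1). *)
Lemma frieze_glide (i m : int) :
    (forall m' j' : int, i + 1 <= m' -> m' <= j' -> j' <= i + n%:Z ->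
       c m' j' != 0) ->
    i + 1 <= m -> m <= i + n%:Z + 2 ->
  c m (i + n%:Z + 1) = c i (m - 2).
Proof.
move=> nz im mn; rewrite (frieze_plucker i) //;
  [|by move=> m' j' h1 _; apply: nz|lia].
rewrite c_bot0 mul0r subr0.
have -> : i + n%:Z + 1 = i + 1 + n%:Z by lia.
by rewrite c_bot1 mulr1.
Qed.

Lemma nz_triangle_succ i : nz_triangle i -> nz_triangle (i + 1).
Proof.
move=> nz m j im mj jn; have [jn'|jn'] := leP j (i + n%:Z).
  by apply: nz => //; lia.
have -> : j = i + n%:Z + 1 by lia.
rewrite frieze_glide; [|by move=> m' j' *; apply: nz; lia|lia|lia].
have [->|mi] := eqVneq m (i + 1); last by apply: nz; lia.
have -> : i + 1 - 2 = i - 1 by lia.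
by rewrite c_top1 oner_neq0.
Qed.

Lemma nz_triangle_pred i : nz_triangle (i + 1) -> nz_triangle i.
Proof.
move=> nz m j im mj jn; have [mi|mi] := leP (i + 1) m.
  by apply: nz => //; lia.
have -> : m = i by lia.
have -> : j = j + 2 - 2 by lia.
rewrite -frieze_glide; [|by move=> m' j' *; apply: nz; lia|lia|lia].
have [->|ji] := eqVneq j (i + n%:Z); last by apply: nz; lia.
have -> : i + n%:Z + 1 = i + n%:Z + 2 - 1 by lia.
by rewrite c_top1 oner_neq0.
Qed.

Lemma nz_triangle_all i0 : nz_triangle i0 -> forall i, nz_triangle i.
Proof.
move=> nz0; apply: (int_two_way_ind nz_triangle i0) => //.
  exact: nz_triangle_succ.
exact: nz_triangle_pred.
Qed.

End CoxeterFrieze.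

(** * Nonvanishing for the generic diagonal *)

(** For sequences p and q with p_k q_(k+1) - q_k p_(k+1) = 1, the numerator of the
    minor p_r q_s - p_s q_r, s = r + t + 1, as a fraction with denominator
    p_(r+1) ... p_(s-1); it does not involve q. *)
Fixpoint bracket_num (R : comNzRingType) (p : nat -> R) (r t : nat) : R :=
  if t is t'.+1 then
    p (r + t').+2 * bracket_num R p r t' + \prod_(r <= l < (r + t').+1) p l
  else 1.

Lemma rmorph_bracket_num (R S : comNzRingType) (f : {rmorphism R -> S})
    (p : nat -> R) r t :
  f (bracket_num R p r t) = bracket_num S (fun k => f (p k)) r t.
Proof.
elim: t => [|t IH] /=; first exact: rmorph1.
by rewrite rmorphD rmorphM IH rmorph_prod.
Qed.

Lemma bracket_numE (R : comNzRingType) (p q : nat -> R) r t :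
    (forall k, (r <= k <= r + t)%N -> p k * q k.+1 - q k * p k.+1 = 1) ->
  (p r * q (r + t).+1 - p (r + t).+1 * q r) * \prod_(r.+1 <= l < (r + t).+1) p l
    = bracket_num R p r t.
Proof.
elim: t => [|t IH] u /=.
  rewrite addn0 big_geq ?mulr1 // mulrC [_ * q r]mulrC.
  by rewrite [q r.+1 * _]mulrC u // addn0 leqnn.
rewrite -IH => [|k hk]; last by apply: u; lia.
have := u (r + t.+1)%N ltac:(lia); rewrite addnS => u1.
rewrite [\prod_(r.+1 <= l < (r + t).+2) _]big_nat_recr /=; last lia.
rewrite [\prod_(r <= l < _) _]big_ltn ?ltnS ?leq_addr //.
move: (\prod_(_ <= _ < _) _) => P.
rewrite -[p r * P]mul1r -u1.
move: (p r) (q r) (p (r+t).+1) (q (r+t).+1) (p (r+t).+2) (q (r+t).+2).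
by move=> *; ring.
Qed.

(** The numerator is the sum over r < k <= s of the products of the p_l, for
    r <= l <= s and l different from k - 1 and k. If exactly one of p_r, ..., p_s is
    0 and the others are 1, it is thus 1 when the zero is at an end, and 2
    otherwise. *)
Lemma bracket_num_zero_first (R : comNzRingType) (p : nat -> R) r t :
  p r = 0 -> (forall k, (r < k <= (r + t).+1)%N -> p k = 1) ->
  bracket_num R p r t = 1.
Proof.
move=> p0; elim: t => //= t IH p1.
rewrite IH => [|k hk]; last by apply: p1; lia.
by rewrite big_ltn ?ltnS ?leq_addr // p0 mul0r p1 ?mulr1 ?addr0 //; lia.
Qed.

Lemma bracket_num_zero_last (R : comNzRingType) (p : nat -> R) r t :
  p (r + t).+1 = 0 -> (forall k, (r <= k <= r + t)%N -> p k = 1) ->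
  bracket_num R p r t = 1.
Proof.
case: t => //= t; rewrite addnS => -> p1; rewrite mul0r add0r.
by rewrite big_nat big1 // => l hl; apply: p1; lia.
Qed.

Lemma bracket_num_zero_second (R : comNzRingType) (p : nat -> R) r t :
  p r = 1 -> p r.+1 = 0 -> (forall k, (r.+1 < k <= r + t.+2)%N -> p k = 1) ->
  bracket_num R p r t.+1 = 2%:R.
Proof.
move=> pr0 pr1; elim: t => [|t IH] p1.
  by rewrite /= addn0 big_nat1 pr0 mulr1 p1 //; lia.
rewrite [LHS]/= -/(bracket_num R p r t.+1) IH => [|k hk]; last by apply: p1; lia.
rewrite big_ltn ?ltnS ?leq_addr // big_ltn ?pr1 ?mul0r ?mulr0 ?addr0; last lia.
by rewrite p1 ?mul1r //; lia.
Qed.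

Lemma mpolyX_neq0 (K : fieldType) (n : nat) (i : 'I_n) :
  'X_i != 0 :> {mpoly K[n]}.
Proof.
apply: contraTneq isT => /(congr1 (mcoeff U_(i)%MM)).
by rewrite mcoeffXU eqxx mcoeff0 => /eqP; rewrite oner_eq0.
Qed.

Section GenericDiagonal.
Variables (K : fieldType) (n : nat).

(** The generic diagonal 1, x_1, ..., x_n, 1, extended by 1. *)
Definition diag_poly (k : nat) : {mpoly K[n]} :=
  if k is k'.+1 then (if insub k' is Some i then 'X_i else 1) else 1.

(** The point at which [diag_poly] takes the values v, if v has the value 1 at 0
    and beyond n. *)
Definition diag_eval (v : nat -> K) : 'I_n -> K := fun i => v i.+1.

Lemma diag_polyE v k : v 0%N = 1 -> (forall l, (n < l)%N -> v l = 1) ->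
  meval (diag_eval v) (diag_poly k) = v k.
Proof.
move=> v0 vn; case: k => [|k] /=; first by rewrite rmorph1.
case: insubP => [i _ <-|]; first by rewrite mevalXU.
by rewrite -leqNgt => nk; rewrite rmorph1 vn.
Qed.

Lemma bracket_num_neq0 r t : 2%:R != 0 :> K -> (r + t <= n)%N -> (0 < n)%N ->
  bracket_num _ diag_poly r t != 0.
Proof.
move=> two rt n0.
have [v [v0 vn nz]] : exists v : nat -> K, [/\ v 0%N = 1,
  forall l, (n < l)%N -> v l = 1 & bracket_num K v r t != 0].
  (* A zero at r or at r + t + 1 gives the value 1. If these are the two ends 0
     and n + 1 of the diagonal, where v is 1, a zero at 1 gives 2. *)
  have [r0|r0] := posnP r.
    have [tn|tn] := eqVneq t n.
      exists (fun l => if l == 1 then 0 else 1); split=> // [l ln|].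
        by case: eqP => // e; lia.
      move: tn n0; case: (t) => [<- //|t' tn n0].
      rewrite r0 bracket_num_zero_second // => k hk; case: eqP => //; lia.
    exists (fun l => if l == t.+1 then 0 else 1); split=> // [l ln|].
      by case: eqP => // e; lia.
    rewrite bracket_num_zero_last ?oner_neq0 ?r0 ?eqxx // => k hk.
    by case: eqP => // e; lia.
  exists (fun l => if l == r then 0 else 1); split=> [|l ln|].
  - by case: eqP => // e; lia.
  - by case: eqP => // e; lia.
  rewrite bracket_num_zero_first ?oner_neq0 ?eqxx // => k hk.
  by case: eqP => // e; lia.
apply: contraNneq nz => /(congr1 (meval (diag_eval v))).
rewrite rmorph0 rmorph_bracket_num /= => <-; apply/eqP.
elim: t {rt} => //= t IH; rewrite IH -(diag_polyE v (r + t).+2) //; congr (_ + _).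
by apply: eq_bigr => l _; rewrite diag_polyE.
Qed.

End GenericDiagonal.

Section GenericTriangle.
Variables (K : fieldType) (n : nat).
Local Notation F := {fraction {mpoly K[n]}}.
Variable c : int -> int -> F.
Hypothesis cF : coxeter_frieze F n c.
Hypotheses (c_x : forall i : 'I_n, c 0 i%:Z = tofrac 'X_i)
  (two : 2%:R != 0 :> K) (n_gt0 : (0 < n)%N).

Lemma generic_nz_triangle : nz_triangle _ n c 0.
Proof.
(* p lists the diagonal c_(0,j) starting at j = -1, so that p_k = c_(0,k-1). *)
pose p k : F := tofrac (diag_poly K n k).
have pE k : (k <= n.+1)%N -> p k = c 0 (k%:Z - 1).
  move=> kn; rewrite /p; case: k kn => [|k] kn /=.
    by rewrite rmorph1; have := cf_top1 _ _ _ cF 0.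
  have -> : k.+1%:Z - 1 = k%:Z by lia.
  case: insubP => [i _ <-|]; first by rewrite c_x.
  rewrite -leqNgt => nk; have -> : k = n by lia.
  by rewrite rmorph1; have := cf_bot1 _ _ _ cF 0; rewrite add0r.
move=> m j /int_offset[m' ->]; rewrite add0r => {m} mj jn.
have [j' e] := int_offset 0 j ltac:(lia); move: mj jn; rewrite e !add0r => {j e}.
rename j' into j; rename m' into m; have [N] := ubnP m.
elim: N m j => // N IH m j mN mj jn.
case: m => [|r] in mN mj *.
  have := pE j.+1 ltac:(lia); have -> : j.+1%:Z - 1 = j%:Z by lia.
  move=> <-; rewrite /p tofrac_eq0 /=; case: insubP => [i _ _|_].
    exact: mpolyX_neq0.
  by rewrite oner_eq0.
(* The diagonal r + 1 consists of the minors whose first column has index r. *)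
rewrite (frieze_plucker _ _ _ cF 0); first last.
- lia.
- lia.
- lia.
- move=> m1 j1 /int_offset[m' ->] h2 h3 h4.
  have [j' e] := int_offset 0 j1 ltac:(lia); rewrite e in h3 h4 *.
  have -> : 0 + 1 + m'%:Z = m'.+1%:Z by lia.
  by rewrite add0r; apply: IH; lia.
pose t := (j - r)%N.
have u k : (r <= k <= r + t)%N ->
    p k * c 1 (k.+1%:Z - 1) - c 1 (k%:Z - 1) * p k.+1 = 1.
  move=> hk; have := cf_rule _ _ _ cF 0 (k%:Z - 1) ltac:(lia).
  rewrite !pE; [|lia|lia]; rewrite add0r subrK.
  by have -> : k.+1%:Z - 1 = k%:Z by lia.
have := bracket_numE _ p (fun k => c 1 (k%:Z - 1)) r t u.
rewrite /p -rmorph_bracket_num -!/(p _) !pE; [|lia|lia].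
have -> : (r + t).+1%:Z - 1 = j%:Z by lia.
have -> : r.+1%:Z - 2 = r%:Z - 1 by lia.
move=> e; have nz : tofrac (bracket_num _ (diag_poly K n) r t) != 0.
  by rewrite tofrac_eq0; apply: bracket_num_neq0; lia.
by apply: contraNneq nz => e0; rewrite -e e0 mul0r.
Qed.

End GenericTriangle.

(** * The shift rule *)

Section Shift.
Variables (R : pzRingType) (G : supercommutative R) (n : nat).
Variable s : superfrieze G n.
Hypothesis sqr0 : forall z, z \in odd_el G -> z * z = 0.

Local Notation a := (sf_a s).
Local Notation b := (sf_b s).
Local Notation h := (sf_h s).

(** The a_(i+1,j') are cancellable, so the diamonds (i+1,j) determine the entries
    of the left-hand sides by induction on j; the diamonds (i,j) show that the
    right-hand sides satisfy the same relations. *)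
Lemma sf_shift (i j : int) :
    (forall j' : int, i < j' -> j' <= i + n%:Z -> GRing.lreg (a (i + 1) j')) ->
    i <= j -> j <= i + n%:Z + 1 ->
  a (i + 2) j = a i i * a (i + 1) j - a i j + h i i * h i j
  /\ h (i + 1) j = h i j - h i i * a (i + 1) j.
Proof.
move=> reg /int_offset[t {j}->].
elim: t => [|t IH] jn.
  have a1 : a (i + 1) i = 1 by have := sf_a_top1 s (i + 1); rewrite addrK.
  have a2 : a (i + 2) i = 0 by have := sf_a_top0 s (i + 2); rewrite addrK.
  have h1 : h (i + 1) i = 0 by have := sf_h_top s (i + 1); rewrite addrK.
  have hodd : h i i \in odd_el G by apply: sf_h_odd; lia.
  by rewrite addr0 a1 a2 h1 !mulr1 !subrr sqr0 // addr0.
have {IH} [IHa IHh] := IH ltac:(lia).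
have jE : i + t.+1%:Z = i + t%:Z + 1 by lia.
have iE : i + 2 = i + 1 + 1 by lia.
rewrite jE iE in IHa IHh *.
set j := i + t%:Z in IHa IHh *.
have [e1 _ e2 _] := @sf_diamond _ _ _ s i j ltac:(lia).
have [f1 _ _ f2] := @sf_diamond _ _ _ s (i + 1) j ltac:(lia).
have areg : GRing.lreg (a (i + 1) j).
  have [->|/eqP ji] := eqVneq j i; last by apply: reg; lia.
  have -> : a (i + 1) i = 1 by have := sf_a_top1 s (i + 1); rewrite addrK.
  by move=> x y; rewrite !mul1r.
have ev (m l : int) : -2 <= l - m <= n%:Z + 1 -> forall z, a m l * z = z * a m l.
  by move=> hml z; apply/even_el_comm/sf_a_even.
have ho (m l : int) : -1 <= l - m <= n%:Z + 1 -> h m l \in odd_el G.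
  exact: sf_h_odd.
have BB : h i i * h i i = 0 by apply: sqr0; apply: ho; lia.
have Bal := odd_el_anticomm _ _ _ _ (ho i i ltac:(lia)) (ho i (j + 1) ltac:(lia)).
move: e1 e2 f1 f2 areg IHa IHh BB Bal (ev (i + 1) j ltac:(lia))
  (ev (i + 1) (j + 1) ltac:(lia)).
move: (h i i) (h i j) (h i (j + 1)) (h (i + 1) j) (h (i + 1) (j + 1)).
move: (a (i + 1) j) (a (i + 1) (j + 1)) (a i j) (a i (j + 1)) (a i i).
move: (a (i + 1 + 1) j) (a (i + 1 + 1) (j + 1)) (b (i + 1) (j + 1)).
(* A prime shifts j; w, p, q are a_(i+2,j), a_(i+1,j), a_(i,j), while k = a_(i,i),
   B = h_(i,i), g = b_(i+1,j+1), al = h_(i,j), de = h_(i,j+1), al' = h_(i+1,j) and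
   de' = h_(i+1,j+1). *)
move=> w w' g p p' q q' k B al de al' de' e1 e2 f1 f2 preg IHa IHh BB Bde cp cp'.
have hE : de' = de - B * p'.
  apply: preg; apply: (addIr (- (p' * al'))); rewrite f2 -e2 IHh !mulrBr opprB.
  rewrite addrA; congr (_ + _); rewrite (cp (B * p')) (cp' (B * p)) -!mulrA.
  by rewrite (cp p') addrNK.
split=> //; apply: preg; apply: (addIr (- (w * p'))); rewrite f1 hE IHh IHa.
have t1 : de * (B * p) = - (p * (B * de)) by rewrite mulrA cp Bde mulNr opprK.
have t2 : B * p' * al = B * al * p' by rewrite -!mulrA cp'.
have t3 : B * p' * (B * p) = 0 by rewrite -mulrA cp' -mulrA (mulrA B) BB mul0r.
have t4 : p * (k * p') = k * p * p' by rewrite mulrA cp.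
rewrite mulrBl !mulrBr t1 t2 t3 subr0 opprK addrA addrA -e1.
rewrite mulrDr mulrBr mulrDl mulrBl t4 opprD opprB !addrA.
by rewrite [RHS](ACl (1*5*4*2*3*6))/= subrr add0r.
Qed.

End Shift.

(** * Propagation from two diagonals to all entries *)

Section Membership.
Variables (R : pzRingType) (G : supercommutative R) (n : nat).
Variable s : superfrieze G n.
Hypothesis sqr0 : forall z, z \in odd_el G -> z * z = 0.
Hypothesis reg : forall i j : int, i <= j -> j < i + n%:Z -> GRing.lreg (sf_a s i j).
Variable S : R -> Prop.
Hypotheses (S0 : S 0) (S1 : S 1) (SD : forall z w, S z -> S w -> S (z + w))
  (SN : forall z, S z -> S (- z)) (SM : forall z w, S z -> S w -> S (z * w)).

Local Notation a := (sf_a s).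
Local Notation b := (sf_b s).
Local Notation h := (sf_h s).

Let SB z w : S z -> S w -> S (z - w).
Proof. by move=> Sz Sw; apply/SD/SN. Qed.

(** The parts of the diagonals i and i + 1 on which all the others depend. *)
Definition diags_in (i : int) :=
  [/\ forall j, i - 2 <= j -> j <= i + n%:Z + 1 -> S (a i j),
      forall j, i - 1 <= j -> j <= i + n%:Z + 2 -> S (a (i + 1) j) &
      forall j, i - 1 <= j -> j <= i + n%:Z + 1 -> S (h i j)].

Let shift (i j : int) : i <= j -> j <= i + n%:Z + 1 ->
  a (i + 2) j = a i i * a (i + 1) j - a i j + h i i * h i j
  /\ h (i + 1) j = h i j - h i i * a (i + 1) j.
Proof.
apply: sf_shift => // j' h1 h2; have [->|/eqP j'n] := eqVneq j' (i + 1 + n%:Z).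
  by rewrite sf_a_bot1 => x y; rewrite !mul1r.
by apply: reg; lia.
Qed.

Lemma diags_in_succ i : diags_in i -> diags_in (i + 1).
Proof.
move=> [Sa Sa1 Sh]; split=> j h1 h2; first by apply: Sa1; lia.
- have -> : i + 1 + 1 = i + 2 by lia.
  have [j1|j1] := leP j (i + n%:Z + 1).
    have [|-> _] := shift i j _ j1; first lia.
    by apply: SD; [apply: SB; [apply: SM|]|apply: SM];
      (apply: Sa || apply: Sa1 || apply: Sh); lia.
  have [->|/eqP jn] := eqVneq j (i + 2 + n%:Z); first by rewrite sf_a_bot1.
  have -> : j = i + 2 + n%:Z + 1 by lia.
  by rewrite sf_a_bot0.
have [->|/eqP ji] := eqVneq j (i + 1 - 1); first by rewrite sf_h_top.
have [j1|j1] := leP j (i + n%:Z + 1).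
  have [|_ ->] := shift i j _ j1; first lia.
  by apply: SB; [|apply: SM]; (apply: Sa1 || apply: Sh); lia.
have -> : j = i + 1 + n%:Z + 1 by lia.
by rewrite sf_h_bot.
Qed.

(** By [ea] and [eh] below, the shift rule at the bottom boundary expresses a_(i,i)
    and beta_(i,i) through the diagonals i + 1 and i + 2. *)
Lemma diags_in_pred i : diags_in (i + 1) -> diags_in i.
Proof.
move=> [Sa1 Sa2 Sh1].
have iE : i + 1 + 1 = i + 2 by lia.
have [ea eh] := shift i (i + n%:Z + 1) ltac:(lia) ltac:(lia).
have a1 : a (i + 1) (i + n%:Z + 1) = 1.
  by have := sf_a_bot1 s (i + 1); congr (a _ _ = _); lia.
rewrite sf_a_bot0 sf_h_bot a1 !mulr1 mulr0 subr0 addr0 in ea.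
rewrite sf_h_bot a1 mulr1 sub0r in eh.
have Saii : S (a i i) by rewrite -ea -iE; apply: Sa2; lia.
have Shii : S (h i i) by rewrite -[h i i]opprK -eh; apply/SN/Sh1; lia.
have Sh j : i - 1 <= j -> j <= i + n%:Z + 1 -> S (h i j).
  move=> h1 h2; have [->|/eqP ji] := eqVneq j (i - 1); first by rewrite sf_h_top.
  have [|_ e] := shift i j _ h2; first lia.
  have -> : h i j = h (i + 1) j + h i i * a (i + 1) j by rewrite e subrK.
  by apply: SD; [|apply: SM => //]; (apply: Sa1 || apply: Sh1); lia.
split=> // j h1 h2; last by apply: Sa1; lia.
have [->|/eqP j2] := eqVneq j (i - 2); first by rewrite sf_a_top0.
have [->|/eqP j1] := eqVneq j (i - 1); first by rewrite sf_a_top1.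
have [|e _] := shift i j _ h2; first lia.
have -> : a i j = a i i * a (i + 1) j + h i i * h i j - a (i + 2) j.
  by apply/eqP; rewrite eq_sym subr_eq e addrA [a i j + _]addrC subrK.
rewrite -iE; apply: SB; last by apply: Sa2; lia.
by apply: SD; apply: SM => //; [apply: Sa1|apply: Sh]; lia.
Qed.

Lemma sf_entry_in i0 : diags_in i0 -> forall z, sf_entry s z -> S z.
Proof.
move=> D0; have Dall i : diags_in i.
  apply: (int_two_way_ind diags_in i0) => //; first exact: diags_in_succ.
  exact: diags_in_pred.
move=> z [i [j [[ij ->]|[ij zE]]]]; have [Sa _ Sh] := Dall i.
  by apply: Sa; lia.
case: zE => ->; last by apply: Sh; lia.
have [->|/eqP ji] := eqVneq j (i - 1); first by rewrite sf_b_top.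
(* The fourth diamond relation: A delta - C alpha = gamma. *)
have := @sf_diamond _ _ _ s i (j - 1) ltac:(lia); rewrite subrK => -[_ _ _ <-].
by apply: SB; apply: SM; (apply: Sa || apply: Sh); lia.
Qed.

End Membership.

(** * Mutating along the chain of even vertices *)

Lemma prod_neighbours (R : pzSemiRingType) (X : nat -> R) n k : (k < n)%N ->
  \prod_(0 <= j < n) X j ^+ ((j.+1 == k) || (j == k.+1))
    = (if (0 < k)%N then X k.-1 else 1) * (if (k.+1 < n)%N then X k.+1 else 1).
Proof.
move=> kn; rewrite (big_cat_nat (n := k)) ?(ltnW kn) //= (big_ltn kn).
rewrite (_ : X k ^+ _ = 1) ?mul1r; last first.
  by rewrite gtn_eqF // ltn_eqF // expr0.
congr (_ * _).
  case: k kn => [|k] kn; first by rewrite big_geq.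
  rewrite big_nat_recr //= eqxx expr1 big_nat big1 ?mul1r // => j hj.
  have -> : (j.+1 == k.+1) || (j == k.+2) = false by lia.
  by rewrite expr0.
case: ltnP => h; last by rewrite big_geq.
rewrite big_ltn // eqxx orbT expr1 big_nat big1 ?mulr1 // => j hj.
have -> : (j.+1 == k) || (j == k.+1) = false by lia.
by rewrite expr0.
Qed.

Section Seeds.
Variables (R : unitRingType) (G : supercommutative R) (n : nat).
Variables (s : superfrieze G n) (t : seed G n n.+1).
Hypotheses (t_quiver : quiver t = Qtilde n)
  (t_even : forall i : 'I_n, even_var t i = sf_a s 0 i%:Z)
  (t_odd : forall j : 'I_n.+1, odd_var t j = sf_h s 0 j%:Z)
  (t_unit : forall i : 'I_n, even_var t i \is a GRing.unit).

(** The arrows after the mutations at the k first even vertices (numbered from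
    0): only the arrow joining the vertices k - 1 and k is reversed, the ones
    before having been reversed twice. *)
Definition mutated_arrows (k : nat) (v w : 'I_n + 'I_n.+1) : nat :=
  match v, w with
  | inl i, inl j =>
    ((j == i.+1 :> nat) && (j != k :> nat)) || ((i == j.+1 :> nat) && (i == k :> nat))
  | _, _ => Qtilde_arrows v w
  end.

(** After these mutations, the k first even variables x_(i+1) = a_(0,i) have become
    the a_(1,i+1). *)
Definition mutated_seed (k : nat) (t' : seed G n n.+1) :=
  [/\ forall i : 'I_n,
        even_var t' i = if (i < k)%N then sf_a s 1 i.+1%:Z else sf_a s 0 i%:Z,
      forall j : 'I_n.+1, odd_var t' j = sf_h s 0 j%:Z &
      forall v w, arrows (quiver t') v w = mutated_arrows k v w].

(** The exchange relation at the vertex k is the first relation of the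
    diamond (0,k). *)
Lemma even_mut_varE (k : 'I_n) t' : mutated_seed k t' ->
  even_mut_var k t' = sf_a s 1 k.+1%:Z.
Proof.
move=> [ev od ar]; rewrite /even_mut_var.
have loops i : loops_near t' i = 0%N.
  by rewrite /loops_near big1 // => j _; rewrite !ar /= muln0.
have -> : u_exp k t' = 0%N.
  by rewrite /u_exp big1 // => i _; rewrite loops muln0.
have -> : v_exp k t' = 0%N.
  by rewrite /v_exp big1 // => i _; rewrite loops muln0.
rewrite !expr0 !mul1r [X in X + _ + _]big1 => [|i _]; last first.
  by rewrite ar /= (_ : _ || _ = false) ?expr0 //; have := ltn_ord i; lia.
pose X j : R := if (j < k)%N then sf_a s 1 j.+1%:Z else sf_a s 0 j%:Z.
rewrite (eq_bigr (fun j : 'I_n => X j ^+ ((j.+1 == k) || (j == k.+1 :> nat))));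
  last first.
  move=> j _; rewrite ev ar /= /X; congr (_ ^+ nat_of_bool _).
  by have := ltn_ord j; lia.
rewrite -(big_mkord xpredT (fun j => X j ^+ ((j.+1 == k) || (j == k.+1)))).
rewrite prod_neighbours //.
have -> : (if (0 < k)%N then X k.-1 else 1) = sf_a s 1 k%:Z.
  rewrite /X; case: (k : nat) => [|k'] /=; last by rewrite ltnSn.
  by have := sf_a_top1 s 1.
have -> : (if (k.+1 < n)%N then X k.+1 else 1) = sf_a s 0 k.+1%:Z.
  rewrite /X [(k.+1 < k)%N]ltnNge leqnSn /=; case: ltnP => // kn.
  have -> : k.+1 = n by have := ltn_ord k; lia.
  by have := sf_a_bot1 s 0; rewrite add0r.
have -> : \sum_(i < n.+1) \sum_(j < n.+1 | (i != j) &&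
      (arrows (quiver t') (inr i) (inr j) == 0%N))
    (odd_var t' i * odd_var t' j) *+
      (arrows (quiver t') (inr i) (inl k) * arrows (quiver t') (inl k) (inr j))
    = sf_h s 0 k.+1%:Z * sf_h s 0 k%:Z.
  have kn := ltn_ord k.
  rewrite (bigD1 (inord k.+1)) //= [X in _ + X]big1 ?addr0 => [|i ik].
    rewrite (bigD1 (inord k)) /=; last first.
      by rewrite ar /= -val_eqE /= !inordK //; lia.
    rewrite [X in _ + X]big1 ?addr0 => [|j /andP[_ jk]].
      by rewrite !ar !od /= !inordK ?eqxx //; lia.
    rewrite !ar /= [_ == k :> nat](_ : _ = false) ?muln0 //.
    by apply: contraNF jk => /eqP <-; rewrite inord_val.
  apply: big1 => j _; rewrite !ar /= [_ == k.+1 :> nat](_ : _ = false) ?mul0n //.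
  by apply: contraNF ik => /eqP <-; rewrite inord_val.
have kn := ltn_ord k.
have := @sf_diamond _ _ _ s 0 k%:Z ltac:(lia); rewrite add0r.
have -> : k%:Z + 1 = k.+1%:Z by lia.
move=> [e _ _ _]; rewrite ev ltnn.
have -> : 1 + sf_a s 1 k%:Z * sf_a s 0 k.+1%:Z + sf_h s 0 k.+1%:Z * sf_h s 0 k%:Z
  = sf_a s 0 k%:Z * sf_a s 1 k.+1%:Z.
  by rewrite addrAC -e subrK.
by rewrite mulKr // -t_even.
Qed.

Lemma mutated_seed0 : mutated_seed 0 t.
Proof.
split=> // -[i|i] [j|j]; rewrite t_quiver //=.
by have [->|] := eqVneq (j : nat) i.+1 => //=; case: eqP => //; lia.
Qed.

Lemma mutated_seedS (k : 'I_n) t' :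
  mutated_seed k t' -> mutated_seed k.+1 (even_mut k t').
Proof.
move=> st; have vE := even_mut_varE k t' st; have [ev od ar] := st.
split=> [i|//|].
  rewrite [LHS]/= vE ev -val_eqE /= ltnS.
  by have [->|ik] := eqVneq (i : nat) k; rewrite ?leqnn // ltn_neqAle ik.
move=> [i|i] [j|j]; rewrite /= ?ar //= -!val_eqE /=.
have kF x : (x == k.+1) && (x == k :> nat) = false by lia.
rewrite !kF eqxx andbF !mul0n !addn0.
move: (i : nat) (j : nat) (k : nat) => {}i {}j {kF ev ar vE st od}k.
by case: (eqVneq i k); case: (eqVneq j k) => /=; lia.
Qed.

Lemma even_muts_Qtilde k : (k <= n)%N ->
  mutated_seed k (even_muts t (take k (enum 'I_n))).
Proof.
elim: k => [|k IH] kn; first by rewrite take0; exact: mutated_seed0.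
rewrite (take_nth (Ordinal kn)) ?size_enum_ord // /even_muts -cats1 foldl_cat /=.
rewrite [nth _ _ _](_ : _ = Ordinal kn); last first.
  by apply: val_inj; rewrite /= nth_enum_ord.
exact/mutated_seedS/IH/ltnW.
Qed.

End Seeds.

(** * The generic superfrieze *)

Section GenericSuperfrieze.
Variables (K : fieldType) (n : nat).
Hypotheses (charK : 2%N \notin [pchar K]) (n_gt0 : (0 < n)%N).
Variable s : superfrieze (generic_super K n) n.
Hypotheses (s_x : forall i : 'I_n, sf_a s 0 i%:Z = generic_x K i)
  (s_y : forall j : 'I_n.+1, sf_h s 0 j%:Z = generic_y K j).

Lemma two_neq0 : 2%:R != 0 :> K.
Proof. by apply: contraNneq charK => e; rewrite inE /= e eqxx. Qed.

Lemma generic_sqr0 z : z \in odd_el (generic_super K n) -> z * z = 0.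
Proof.
apply: gr_odd_sqr.
have -> : (2%:R : {fraction {mpoly K[n]}}) = tofrac (2%:R%:MP) by rewrite !rmorph_nat.
by rewrite tofrac_eq0 mpolyC_eq0 two_neq0.
Qed.

Lemma generic_entry_lreg i j :
  i <= j -> j < i + n%:Z -> GRing.lreg (sf_a s i j).
Proof.
move=> ij jn; apply: gr_lreg.
(* The bodies of the even entries form a Coxeter frieze. *)
pose c i j := (sf_a s i j) set0.
have cF : coxeter_frieze _ n c.
  split=> [i'|i'|i'|i'|i' j' ij']; rewrite /c.
  - by rewrite sf_a_top0 ffunE.
  - by rewrite sf_a_top1 gr_body1.
  - by rewrite sf_a_bot1 gr_body1.
  - by rewrite sf_a_bot0 ffunE.
  have [e _ _ _] := @sf_diamond _ _ _ s i' j' ij'.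
  have := congr1 (fun f : generic_ring K n => f set0) e.
  rewrite /= gr_bodyB gr_bodyD !gr_bodyM gr_body1 [sf_h s i' j' set0]gr_body_odd.
    by rewrite mulr0 addr0.
  by apply: sf_h_odd; lia.
have c_x (k : 'I_n) : c 0 k%:Z = tofrac 'X_k.
  rewrite /c s_x /generic_x ffunE gr_body1; exact: mulr1.
have nz0 := generic_nz_triangle _ _ c cF c_x two_neq0 n_gt0.
by apply: (nz_triangle_all _ n c cF 0 nz0 i); lia.
Qed.

Lemma generic_x_unit (i : 'I_n) : generic_x K i \is a GRing.unit.
Proof.
have x0 : tofrac ('X_i : {mpoly K[n]}) != 0 by rewrite tofrac_eq0 mpolyX_neq0.
apply/unitrP; exists ((tofrac 'X_i)^-1)%:A; rewrite /generic_x.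
by split; rewrite -scalerAl mul1r scalerA ?mulVf ?mulfV ?scale1r.
Qed.

Lemma generic_mutated_seed k : (k <= n)%N ->
  mutated_seed _ _ _ s k (even_muts (generic_seed K n) (take k (enum 'I_n))).
Proof.
apply: even_muts_Qtilde => //= i; exact: generic_x_unit.
Qed.

Lemma a1_even_mut (i : 'I_n) :
  sf_a s 1 i.+1%:Z
    = even_var (even_muts (generic_seed K n) (take i.+1 (enum 'I_n))) i.
Proof. by have [-> // _ _] := generic_mutated_seed i.+1 (ltn_ord i); rewrite ltnSn. Qed.

Lemma a1_cluster_var (i : 'I_n) :
  even_cluster_var (generic_seed K n) (sf_a s 1 i.+1%:Z).
Proof.
exists (take i.+1 (enum 'I_n)); first exact/take_uniq/enum_uniq.
by exists i; apply: a1_even_mut.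
Qed.

(** The initial variables and the a_(1,j) are cluster variables, so the first two
    diagonals lie in the cluster superalgebra. *)
Lemma sf_entry_cluster z : sf_entry s z ->
  cluster_superalgebra (@generic_scalar K n) (generic_seed K n) z.
Proof.
pose S := cluster_superalgebra (@generic_scalar K n) (generic_seed K n).
have scal c : S (generic_scalar n c) by apply: generated_scalar.
have gs0 : generic_scalar n (0 : K) = 0 by rewrite /generic_scalar !rmorph0 scale0r.
have gsN1 : generic_scalar n (-1 : K) = -1.
  by rewrite /generic_scalar !rmorphN1 scaleN1r.
have gs1 : generic_scalar n (1 : K) = 1 by rewrite /generic_scalar !rmorph1 scale1r.
have S0 : S 0 by rewrite -gs0.
have S1 : S 1 by rewrite -gs1.
have SM x y : S x -> S y -> S (x * y) by apply: generated_mul.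
have D0 : diags_in _ _ _ s S 0.
  split=> j h1 h2.
  - have [->|/eqP j2] := eqVneq j (0 - 2); first by rewrite sf_a_top0.
    have [->|/eqP j1] := eqVneq j (0 - 1); first by rewrite sf_a_top1.
    have [->|/eqP jn] := eqVneq j (0 + n%:Z + 1); first by rewrite sf_a_bot0.
    have [->|/eqP jn1] := eqVneq j (0 + n%:Z); first by rewrite sf_a_bot1.
    have [k e] := int_offset 0 j ltac:(lia).
    have kn : (k < n)%N by lia.
    rewrite e add0r (s_x (Ordinal kn)); apply: generated_mem; left.
    by exists [::] => //; exists (Ordinal kn).
  - have [->|/eqP j2] := eqVneq j (0 + 1 - 2); first by rewrite sf_a_top0.
    have [->|/eqP j1] := eqVneq j (0 + 1 - 1); first by rewrite sf_a_top1.
    have [->|/eqP jn] := eqVneq j (0 + 1 + n%:Z + 1); first by rewrite sf_a_bot0.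
    have [->|/eqP jn1] := eqVneq j (0 + 1 + n%:Z); first by rewrite sf_a_bot1.
    have [k e] := int_offset 1 j ltac:(lia).
    have kn : (k < n)%N by lia.
    have -> : j = k.+1%:Z by lia.
    by rewrite add0r; apply: generated_mem; left; apply: (a1_cluster_var (Ordinal kn)).
  have [->|/eqP j1] := eqVneq j (0 - 1); first by rewrite sf_h_top.
  have [->|/eqP jn] := eqVneq j (0 + n%:Z + 1); first by rewrite sf_h_bot.
  have [k e] := int_offset 0 j ltac:(lia).
  have kn : (k < n.+1)%N by lia.
  rewrite e add0r (s_y (Ordinal kn)); apply: generated_mem; right.
  by exists [::], (Ordinal kn).
apply: sf_entry_in D0 z => //; first exact: generic_sqr0.
- exact: generic_entry_lreg.
- by move=> x y; apply: generated_add.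
by move=> x Sx; rewrite -mulN1r -gsN1; apply: SM.
Qed.

End GenericSuperfrieze.

Lemma generated_sub (K R : pzRingType) (iota : K -> R) (P Q : R -> Prop) :
  (forall z, P z -> generated iota Q z) ->
  forall z, generated iota P z -> generated iota Q z.
Proof.
move=> PQ z; elim=> [{}z /PQ //|c|x y _ Sx _ Sy|x y _ Sx _ Sy].
- exact: generated_scalar.
- exact: generated_add.
exact: generated_mul.
Qed.

Theorem theorem7p2 (K : fieldType) (n : nat)
    (charK : 2%N \notin [pchar K]) (n_gt0 : (0 < n)%N)
    (s : superfrieze (generic_super K n) n)
    (s_x : forall i : 'I_n, sf_a s 0 i%:Z = generic_x K i)
    (s_y : forall j : 'I_n.+1, sf_h s 0 j%:Z = generic_y K j) :
  (forall z : generic_ring K n,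
     generated (@generic_scalar K n) (sf_entry s) z ->
     cluster_superalgebra (@generic_scalar K n) (generic_seed K n) z)
  /\
  (forall i : 'I_n,
     sf_a s 1 i.+1%:Z
       = even_var (even_muts (generic_seed K n) (take i.+1 (enum 'I_n))) i
     /\ even_cluster_var (generic_seed K n) (sf_a s 1 i.+1%:Z)).
Proof.
split=> [|i]; last by split; [exact: a1_even_mut|exact: a1_cluster_var].
by apply: generated_sub; apply: sf_entry_cluster.
Qed.
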